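(* For $c\in[0,2]$ and $a\in[-1,1]$, let $F_{c,a}=H_{c,a}+\overline{G_{c,a}}\in\mathcal{S}_H^0$ be such that $$H_{c,a}(z)-G_{c,a}(z)=k_c(z)\quad\text{and}\quad \omega_a(z)=\frac{G_{c,a}'(z)}{H_{c,a}'(z)}=z\,\frac{z+a}{1+az},$$ where $k_c$ is the generalized Koebe function. Then $F_{c,a}(\mathbb{D})$ is convex in the horizontal direction, and as $c$ varies from $0$ to $2$, $F_{c,a}(\mathbb{D})$ transforms from a strip mapping to a slit mapping.
   Context: $\mathbb{D}=\{z\in\mathbb{C}:|z|<1\}$. $\mathcal{S}_H^0$ is the class of sense-preserving univalent (injective) harmonic mappings $f=h+\overline{g}$ on $\mathbb{D}$ with $h,g$ analytic, $h(0)=g(0)=0$, $h'(0)=1$, $g'(0)=0$. The dilatation of $f$ is $\omega=g'/h'$. For $a=1$, $a=0$ and $a=-1$, $\omega_a(z)$ is $z$, $z^2$ and $-z$ respectively. For $c\in(0,2]$ the generalized Koebe function is $$k_c(z)=\int_0^z\frac{(1+\zeta)^{c-1}}{(1-\zeta)^{c+1}}\,d\zeta=\frac{1}{2c}\left[\left(\frac{1+z}{1-z}\right)^c-1\right],$$ and for $c=0$ it is the limit $k_0(z)=\frac12\log\frac{1+z}{1-z}$ (principal branches). A domain $\Omega\subset\mathbb{C}$ is convex in the horizontal direction if its intersection with every horizontal line is connected or empty. The phrase ''transforms from a strip mapping to a slit mapping'' is informal in the source and is not given a formal definition there. It refers to the endpoints of the range of $c$: ''strip mapping'' refers to $F_{0,a}$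 (the case $c=0$), which the source's proof describes as mapping $\mathbb{D}$ onto the horizontal strip $\{\zeta\in\mathbb{C}:|\operatorname{Im}\zeta|<\pi/4\}$, and ''slit mapping'' refers to $F_{2,a}$ (the case $c=2$), which the source's proof describes as mapping $\mathbb{D}$ onto the plane minus the real interval $(-\infty,-(2-a)/6]$.
   Formalization: ''Strip'' and ''slit'' are read as the images at c=0 and c=2; the full strip is claimed only for |a|<1 (for a=1 and a=-1 the image is the strip cut by Re w>-1/2, resp. Re w<1/2) and the slit plane only for a>-1 (for a=-1 it is the half-plane Re w>-1/2), since the claims fail there. *)

(* Defs.v *)
From Stdlib Require Import Reals.
From Coquelicot Require Import Coquelicot.
Open Scope R_scope.

(** Principal branches. *)

(* Principal argument, with values in (-PI, PI]; Stdlib has no two-argument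
   arctangent. *)
Definition Carg (z : C) : R :=
  if Rle_dec 0 (Im z) then acos (Re z / Cmod z) else - acos (Re z / Cmod z).

Definition Clog (z : C) : C := (ln (Cmod z), Carg z).

Definition Cexp (z : C) : C := (exp (Re z) * cos (Im z), exp (Re z) * sin (Im z)).

Definition Crpower (z : C) (c : R) : C := Cexp (RtoC c * Clog z)%C.

(** Generalized Koebe function. *)

Definition gen_koebe (c : R) (z : C) : C :=
  let w := ((1 + z) / (1 - z))%C in
  if Req_EM_T c 0 then (/ 2 * Clog w)%C
  else (/ (2 * RtoC c) * (Crpower w c - 1))%C.

(** Harmonic mappings.  Functions on the disk are total functions on [C] of which
    only the values on the disk matter. *)

Definition unit_disk (z : C) : Prop := Cmod z < 1.

Definition holomorphic_on (D : C -> Prop) (f : C -> C) : Prop :=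
  forall z, D z -> ex_derive (K := C_AbsRing) (V := C_NormedModule) f z.

Definition harmonic_map (h g : C -> C) (z : C) : C := (h z + Cconj (g z))%C.

(* The Jacobian determinant of [harmonic_map h g] is |h'|^2 - |g'|^2. *)
Definition harmonic_jacobian (h g : C -> C) (z : C) : R :=
  Cmod (C_derive h z) ^ 2 - Cmod (C_derive g z) ^ 2.

(* [S_H0 h g] says that h + conj g belongs to the class S_H^0; the normalization
   g(0) = 0 makes the pair (h, g) unique on the disk. *)
Record S_H0 (h g : C -> C) : Prop := {
  S_H0_holo_h : holomorphic_on unit_disk h;
  S_H0_holo_g : holomorphic_on unit_disk g;
  S_H0_h0 : h 0%C = 0%C;
  S_H0_g0 : g 0%C = 0%C;
  S_H0_dh0 : C_derive h 0%C = 1%C;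
  S_H0_dg0 : C_derive g 0%C = 0%C;
  S_H0_sense_preserving : forall z, unit_disk z -> 0 < harmonic_jacobian h g z;
  S_H0_univalent : forall z1 z2, unit_disk z1 -> unit_disk z2 ->
    harmonic_map h g z1 = harmonic_map h g z2 -> z1 = z2
}.

Definition dilatation (h g : C -> C) (z : C) : C := (C_derive g z / C_derive h z)%C.

Definition omega (a : R) (z : C) : C := (z * ((z + RtoC a) / (1 + RtoC a * z)))%C.

(* [(h, g)] is the canonical decomposition (H_{c,a}, G_{c,a}) of F_{c,a}. *)
Definition is_F (c a : R) (h g : C -> C) : Prop :=
  S_H0 h g /\
  (forall z, unit_disk z -> (h z - g z)%C = gen_koebe c z) /\
  (forall z, unit_disk z -> dilatation h g z = omega a z).

(** Planar sets. *)

Definition image (f : C -> C) (D : C -> Prop) (w : C) : Prop :=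
  exists z, D z /\ f z = w.

Definition set_eq (A B : C -> Prop) : Prop := forall w, A w <-> B w.

(* Coquelicot's [is_connected] is only about subsets of the real line.  The empty
   set is connected here. *)
Definition connected (A : C -> Prop) : Prop :=
  forall U V : C -> Prop, open U -> open V ->
    (forall z, A z -> U z \/ V z) ->
    (exists z, A z /\ U z) -> (exists z, A z /\ V z) ->
    exists z, A z /\ U z /\ V z.

Definition domain (A : C -> Prop) : Prop :=
  (exists z, A z) /\ open A /\ connected A.

Definition convex_in_horizontal_direction (A : C -> Prop) : Prop :=
  domain A /\ forall y : R, connected (fun w => A w /\ Im w = y).

Definition horizontal_strip (w : C) : Prop := Rabs (Im w) < PI / 4.

(* The plane minus the real ray (-oo, -(2-a)/6]. *)
Definition slit_plane (a : R) (w : C) : Prop := ~ (Im w = 0 /\ Re w <= - (2 - a) / 6).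

(* Main.v *)
Require Import Defs.
From Stdlib Require Import Reals Ranalysis5 Lra Classical.
From Coquelicot Require Import Coquelicot.
Open Scope R_scope.

(** Put [W = (1 + z) / (1 - z) = exp (x + i y)], which identifies the disk with the strip
    [|y| < PI / 2].  In this coordinate [H - G = k_c] and [omega_a] give
    [F = R + i I / 2], where [I] is the imaginary part of [(exp (c (x + i y)) - 1) / c] and
    [R] is the real part of a combination, with weights [(1 + a) / 4] and [(1 - a) / 4], of
    [(exp (m (x + i y)) - 1) / m] for [m = c + 1] and [m = c - 1].  A level set of [I] is a
    single curve along which [R] is strictly monotone, so it is mapped onto a horizontal
    segment; this gives convexity in the horizontal direction, and openness follows by
    applying the intermediate value theorem on neighbouring level curves.  For [c = 0] and
    [c = 2] the ends of these segments are explicit. *)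

(** * Complex derivatives along real paths *)

Lemma Re_le_Cmod (z : C) : Rabs (Re z) <= Cmod z.
Proof. exact (Rle_trans _ _ _ (Rmax_l _ _) (Rmax_Cmod z)). Qed.

Lemma Im_le_Cmod (z : C) : Rabs (Im z) <= Cmod z.
Proof. exact (Rle_trans _ _ _ (Rmax_r _ _) (Rmax_Cmod z)). Qed.

(** Puts complex differentiability into the max-norm form required by the two-variable chain rule
    [derivable_pt_lim_comp_2d]. *)
Lemma C_derive_Cmod_bound (f : C -> C) (x y : R) (l : C) :
  is_derive (K := C_AbsRing) (V := C_NormedModule) f (x, y) l ->
  forall eps : posreal,
  locally_2d (fun u v =>
    Cmod (f (u, v) - f (x, y) - l * (u - x, v - y)%R)%C
      <= eps * Rmax (Rabs (u - x)) (Rabs (v - y))) x y.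
Proof.
  intros [_ Hd] eps.
  (* Halving [eps] absorbs the factor [sqrt 2 <= 2] between [Cmod] and the max norm. *)
  assert (He : 0 < eps / 2) by (destruct eps; simpl; lra).
  specialize (Hd (x, y) (fun P HP => HP) (mkposreal _ He)).
  apply (proj2 (locally_C (x, y) _)) in Hd.
  apply locally_2d_locally.
  revert Hd; apply filter_imp; intros [u v] Hb; simpl in Hb |- *.
  assert (E1 : forall z : C, norm (K := C_AbsRing) (V := C_NormedModule) z = Cmod z)
    by reflexivity.
  rewrite E1 in Hb.
  change (norm (minus (u, v) (x, y))) with (Cmod ((u, v) - (x, y))%C) in Hb.
  change (Cmod ((f (u, v) - f (x, y)) - ((u, v) - (x, y)) * l)%C
    <= eps / 2 * Cmod ((u, v) - (x, y))%C) in Hb.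
  rewrite Cmult_comm in Hb.
  eapply Rle_trans; [exact Hb|].
  pose proof (Cmod_2Rmax ((u, v) - (x, y))%C) as HR. simpl in HR.
  change (u + - x) with (u - x) in HR; change (v + - y) with (v - y) in HR.
  set (M := Rmax _ _) in *.
  assert (0 <= M) by (eapply Rle_trans; [apply Rabs_pos|apply Rmax_l]).
  assert (sqrt 2 <= 2).
  { rewrite <- (sqrt_square 2) at 2 by lra. apply sqrt_le_1_alt; lra. }
  apply Rle_trans with (eps / 2 * (2 * M)); [|lra].
  apply Rmult_le_compat_l; [lra|].
  eapply Rle_trans; [exact HR|]. apply Rmult_le_compat_r; lra.
Qed.

(** By Cauchy-Riemann the real part has partial derivatives [Re l] and [- Im l], the imaginary part
    [Im l] and [Re l]; the real chain rule does the rest. *)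
Lemma is_derive_C_path (f : C -> C) (u v : R -> R) (t du dv : R) (l : C) :
  is_derive u t du -> is_derive v t dv ->
  is_derive (K := C_AbsRing) (V := C_NormedModule) f (u t, v t) l ->
  is_derive (fun s => Re (f (u s, v s))) t (Re (l * (du, dv))%C) /\
  is_derive (fun s => Im (f (u s, v s))) t (Im (l * (du, dv))%C).
Proof.
  intros Hu Hv Hf.
  apply is_derive_Reals in Hu; apply is_derive_Reals in Hv.
  pose proof (C_derive_Cmod_bound f (u t) (v t) l Hf) as Hb.
  split; apply is_derive_Reals.
  - replace (Re (l * (du, dv))%C) with (Re l * du + - Im l * dv)
      by (unfold Re, Im; simpl; ring).
    apply (derivable_pt_lim_comp_2d (fun a b => Re (f (a, b))) u v); trivial.
    intros eps; destruct (Hb eps) as [d Hd]; exists d; intros a b Ha Hb'.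
    eapply Rle_trans; [|exact (Hd a b Ha Hb')].
    eapply Rle_trans; [|apply Re_le_Cmod]. right. f_equal.
    unfold Re, Im; simpl; ring.
  - replace (Im (l * (du, dv))%C) with (Im l * du + Re l * dv)
      by (unfold Re, Im; simpl; ring).
    apply (derivable_pt_lim_comp_2d (fun a b => Im (f (a, b))) u v); trivial.
    intros eps; destruct (Hb eps) as [d Hd]; exists d; intros a b Ha Hb'.
    eapply Rle_trans; [|exact (Hd a b Ha Hb')].
    eapply Rle_trans; [|apply Im_le_Cmod]. right. f_equal.
    unfold Re, Im; simpl; ring.
Qed.

(** * Primitives of exponentials *)

(* The real and imaginary parts of the integral of [exp (m .)] from [0] to [x + i y]. *)
Definition exp_primitive_re (m x y : R) : R :=
  if Req_EM_T m 0 then x else (exp (m * x) * cos (m * y) - 1) / m.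

Definition exp_primitive_im (m x y : R) : R :=
  if Req_EM_T m 0 then y else exp (m * x) * sin (m * y) / m.

(** Differentiation removes the case split on [m]: one formula covers [m = 0] as well. *)
Lemma is_derive_exp_primitive_re (m : R) (u v : R -> R) (t du dv : R) :
  is_derive u t du -> is_derive v t dv ->
  is_derive (fun s => exp_primitive_re m (u s) (v s)) t
    (exp (m * u t) * (cos (m * v t) * du - sin (m * v t) * dv)).
Proof.
  intros Hu Hv.
  assert (Eu : Derive (fun s : R => u s) t = du) by exact (is_derive_unique u t du Hu).
  assert (Ev : Derive (fun s : R => v s) t = dv) by exact (is_derive_unique v t dv Hv).
  unfold exp_primitive_re; destruct (Req_EM_T m 0) as [->|Hm].
  - rewrite !Rmult_0_l, exp_0, cos_0, sin_0. now replace (1 * (1 * du - 0 * dv)) with du by ring.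
  - auto_derive; [split; [now exists du|split; [now exists dv|trivial]]|].
    rewrite Eu, Ev; field; trivial.
Qed.

Lemma is_derive_exp_primitive_im (m : R) (u v : R -> R) (t du dv : R) :
  is_derive u t du -> is_derive v t dv ->
  is_derive (fun s => exp_primitive_im m (u s) (v s)) t
    (exp (m * u t) * (sin (m * v t) * du + cos (m * v t) * dv)).
Proof.
  intros Hu Hv.
  assert (Eu : Derive (fun s : R => u s) t = du) by exact (is_derive_unique u t du Hu).
  assert (Ev : Derive (fun s : R => v s) t = dv) by exact (is_derive_unique v t dv Hv).
  unfold exp_primitive_im; destruct (Req_EM_T m 0) as [->|Hm].
  - rewrite !Rmult_0_l, exp_0, cos_0, sin_0. now replace (1 * (0 * du + 1 * dv)) with dv by ring.
  - auto_derive; [split; [now exists du|split; [now exists dv|trivial]]|].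
    rewrite Eu, Ev; field; trivial.
Qed.

(** * The strip as a coordinate on the disk *)

(* [tanh ((x + i y) / 2)] in coordinates: the point [z] with
   [(1 + z) / (1 - z) = exp (x + i y)]. *)
Definition tanh_half (x y : R) : C :=
  let d := exp x ^ 2 + 2 * exp x * cos y + 1 in
  ((exp x ^ 2 - 1) / d, 2 * exp x * sin y / d).

Lemma cos_strip_pos (y : R) : Rabs y < PI / 2 -> 0 < cos y.
Proof. intros Hy; apply Rabs_def2 in Hy; apply cos_gt_0; lra. Qed.

(** The quantity is [|W + 1|^2] for [W = exp (x + i y)]. *)
Lemma tanh_half_denom_pos (x y : R) :
  0 < cos y -> 0 < exp x ^ 2 + 2 * exp x * cos y + 1.
Proof. intros Hc; pose proof (exp_pos x); nra. Qed.

Lemma Cmod_Cexp (x y : R) : Cmod (Cexp (x, y)) = exp x.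
Proof.
  unfold Cexp, Cmod, Re, Im; simpl.
  replace (exp x * cos y * (exp x * cos y * 1) + exp x * sin y * (exp x * sin y * 1))
    with (exp x * exp x * ((sin y)² + (cos y)²)) by (unfold Rsqr; ring).
  rewrite sin2_cos2, Rmult_1_r. apply sqrt_square, Rlt_le, exp_pos.
Qed.

Lemma Clog_Cexp (x y : R) : Rabs y < PI / 2 -> Clog (Cexp (x, y)) = (x, y).
Proof.
  intros Hy; apply Rabs_def2 in Hy; pose proof PI_RGT_0; pose proof (exp_pos x).
  unfold Clog, Carg; rewrite Cmod_Cexp, ln_exp; f_equal.
  unfold Cexp, Re, Im; simpl.
  replace (exp x * cos y / exp x) with (cos y) by (field; lra).
  destruct (Rle_dec 0 y) as [Hp|Hp].
  - assert (0 <= sin y) by (apply sin_ge_0; lra).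
    destruct (Rle_dec 0 (exp x * sin y)) as [_|N]; [apply acos_cos; lra|].
    exfalso; apply N; nra.
  - assert (0 < sin (- y)) by (apply sin_gt_0; lra). rewrite sin_neg in *.
    destruct (Rle_dec 0 (exp x * sin y)) as [N|_]; [nra|].
    rewrite <- cos_neg, acos_cos; lra.
Qed.

Lemma Cexp_plus (z w : C) : Cexp (z + w)%C = (Cexp z * Cexp w)%C.
Proof.
  unfold Cexp, Re, Im, Cmult; simpl; rewrite exp_plus, cos_plus, sin_plus.
  f_equal; ring.
Qed.

Lemma Cexp_neq_0 (z : C) : Cexp z <> 0%C.
Proof.
  destruct z as [x y]; intros E. pose proof (Cmod_Cexp x y) as H.
  rewrite E, Cmod_0 in H. pose proof (exp_pos x); lra.
Qed.

Lemma Cexp_plus_1_neq_0 (x y : R) : 0 < cos y -> (Cexp (x, y) + 1)%C <> 0%C.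
Proof.
  intros Hc E; apply (f_equal fst) in E; simpl in E. pose proof (exp_pos x); nra.
Qed.

Lemma tanh_half_Cexp (x y : R) :
  0 < cos y -> ((Cexp (x, y) + 1) * tanh_half x y = Cexp (x, y) - 1)%C.
Proof.
  intros Hc; pose proof (tanh_half_denom_pos x y Hc) as Hd.
  pose proof (sin2_cos2 y) as Hs; unfold Rsqr in Hs.
  unfold tanh_half, Cexp, Re, Im; simpl in Hd.
  apply injective_projections; simpl;
  set (e := exp x) in *; set (p := cos y) in *; set (q := sin y) in *;
  field_simplify_eq; try lra.
  replace (q ^ 2) with (1 - p * p) by (rewrite <- Hs; ring). ring.
Qed.

(** A point [W] of the right half-plane is closer to [1] than to [-1], so [(W - 1) / (W + 1)] has
    modulus below [1]. *)
Lemma tanh_half_in_disk (x y : R) : 0 < cos y -> unit_disk (tanh_half x y).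
Proof.
  intros Hc; pose proof (tanh_half_denom_pos x y Hc) as Hd.
  pose proof (sin2_cos2 y) as Hs; pose proof (exp_pos x) as He.
  unfold unit_disk, Cmod; rewrite <- sqrt_1; apply sqrt_lt_1_alt; split.
  { apply Rplus_le_le_0_compat; apply pow2_ge_0. }
  unfold tanh_half; cbn [fst snd].
  set (d := exp x ^ 2 + _ + 1) in *.
  replace (((exp x ^ 2 - 1) / d) ^ 2 + (2 * exp x * sin y / d) ^ 2)
    with (((exp x ^ 2 - 1) ^ 2 + 4 * exp x ^ 2 * (1 - (cos y)²)) / d ^ 2)
    by (rewrite <- Hs; unfold Rsqr; field; lra).
  apply Rlt_div_l; [nra|]. unfold d, Rsqr.
  (* With [k = exp x * cos y], [d ^ 2] exceeds the numerator by [4 k (exp x ^ 2 + 1) + 8 k ^ 2]. *)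
  assert (0 < exp x * cos y) by nra.
  assert (0 < (exp x * cos y) * (exp x ^ 2 + 1)) by nra. nra.
Qed.

Lemma tanh_half_Moebius (x y : R) :
  0 < cos y -> ((1 + tanh_half x y) / (1 - tanh_half x y))%C = Cexp (x, y).
Proof.
  intros Hc. pose proof (tanh_half_Cexp x y Hc) as E.
  pose proof (Cexp_plus_1_neq_0 x y Hc) as N.
  set (W := Cexp (x, y)) in *.
  assert (ET : tanh_half x y = ((W - 1) / (W + 1))%C) by (rewrite <- E; field; trivial).
  rewrite ET. field. split; trivial.
  replace (W + 1 - (W - 1))%C with (RtoC 2) by ring.
  intros E2; apply RtoC_inj in E2; lra.
Qed.

Lemma Cexp_onto_right_half_plane (u v : R) :
  0 < u -> exists x y, Rabs y < PI / 2 /\ Cexp (x, y) = (u, v).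
Proof.
  intros Hu. assert (Hr : 0 < u ^ 2 + v ^ 2) by nra.
  exists (ln (u ^ 2 + v ^ 2) / 2), (atan (v / u)).
  split; [destruct (atan_bound (v / u)); apply Rabs_def1; lra|].
  set (S := sqrt (u ^ 2 + v ^ 2)).
  assert (HS : 0 < S) by (apply sqrt_lt_R0; trivial).
  assert (E : exp (ln (u ^ 2 + v ^ 2) / 2) = S).
  { rewrite <- (sqrt_sqrt (u ^ 2 + v ^ 2)) at 1 by lra. fold S.
    rewrite ln_mult by trivial. replace ((ln S + ln S) / 2) with (ln S) by field.
    apply exp_ln; trivial. }
  assert (E2 : sqrt (1 + (v / u)²) = S / u).
  { unfold S. rewrite <- (sqrt_square u) at 3 by lra.
    rewrite <- sqrt_div_alt by nra. f_equal. unfold Rsqr; field; lra. }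
  unfold Cexp, Re, Im; cbn [fst snd].
  rewrite E, cos_atan, sin_atan, E2. f_equal; field; lra.
Qed.

Lemma tanh_half_onto_disk (z : C) :
  unit_disk z -> exists x y, Rabs y < PI / 2 /\ tanh_half x y = z.
Proof.
  destruct z as [p q]; intros Hz.
  assert (Hn : p ^ 2 + q ^ 2 < 1).
  { unfold unit_disk, Cmod in Hz; simpl fst in Hz; simpl snd in Hz.
    rewrite <- sqrt_1 in Hz. apply sqrt_lt_0_alt in Hz; trivial. }
  assert (Hp : 0 < (1 - p) ^ 2 + q ^ 2) by nra.
  set (D := (1 - p) ^ 2 + q ^ 2) in *.
  (* [u + i v] is [(1 + z) / (1 - z)], and [D] is [|1 - z|^2]. *)
  set (u := (1 - p ^ 2 - q ^ 2) / D). set (v := 2 * q / D).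
  assert (Hu : 0 < u) by (apply Rdiv_lt_0_compat; lra).
  destruct (Cexp_onto_right_half_plane u v Hu) as (x & y & Hy & HW).
  exists x, y; split; trivial. apply cos_strip_pos in Hy.
  pose proof (tanh_half_Cexp x y Hy) as ET. pose proof (Cexp_plus_1_neq_0 x y Hy) as N.
  rewrite HW in ET, N. set (T := tanh_half _ _) in *.
  assert (Ez : (((u, v) + 1) * (p, q) = (u, v) - 1)%C).
  { apply injective_projections; simpl; unfold u, v, D; field; fold D; lra. }
  rewrite <- Ez in ET.
  transitivity (/ ((u, v) + 1) * (((u, v) + 1) * T))%C; [field; trivial|].
  rewrite ET. field; trivial.
Qed.

(** * The harmonic mapping in the strip coordinate *)

Lemma gen_koebe_tanh_half (c x y : R) :
  Rabs y < PI / 2 ->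
  gen_koebe c (tanh_half x y) = (exp_primitive_re c x y / 2, exp_primitive_im c x y / 2).
Proof.
  intros Hy. unfold gen_koebe, Crpower, exp_primitive_re, exp_primitive_im.
  rewrite tanh_half_Moebius, Clog_Cexp by (trivial; apply cos_strip_pos; trivial).
  destruct (Req_EM_T c 0) as [->|Hc].
  - apply injective_projections; simpl; field.
  - apply injective_projections; simpl; rewrite ?Rmult_0_l, ?Rminus_0_r, ?Rplus_0_r; field; lra.
Qed.

(** Existence suffices: in [is_derive_sum_along_ray] these derivatives enter only through products
    with [H'] and [G'], which are determined by [k_c] and [omega]. *)
Lemma ex_derive_tanh_half_ray (x y s : R) :
  Rabs (s * y) < PI / 2 ->
  ex_derive (fun s => fst (tanh_half (s * x) (s * y))) s /\
  ex_derive (fun s => snd (tanh_half (s * x) (s * y))) s.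
Proof.
  intros Hy. pose proof (tanh_half_denom_pos (s * x) (s * y) (cos_strip_pos _ Hy)) as Hd.
  unfold tanh_half; cbn [fst snd]; split; auto_derive; simpl in *; lra.
Qed.

(** Real part of the integral of [exp (c zeta) / 2] times [((1 + a) W + (1 - a) / W) / 2], where
    [W = exp zeta]; the second factor is the one in [omega_shear]. *)
Definition shear_re (c a x y : R) : R :=
  (1 + a) / 4 * exp_primitive_re (c + 1) x y + (1 - a) / 4 * exp_primitive_re (c - 1) x y.

Lemma is_derive_shear_re (c a : R) (u v : R -> R) (t du dv : R) :
  is_derive u t du -> is_derive v t dv ->
  is_derive (fun s => shear_re c a (u s) (v s)) t
    ((1 + a) / 4 * (exp ((c + 1) * u t)
        * (cos ((c + 1) * v t) * du - sin ((c + 1) * v t) * dv)) +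
     (1 - a) / 4 * (exp ((c - 1) * u t)
        * (cos ((c - 1) * v t) * du - sin ((c - 1) * v t) * dv))).
Proof.
  intros Hu Hv; unfold shear_re.
  apply (is_derive_plus (V := R_NormedModule));
    apply (is_derive_scal);
    apply is_derive_exp_primitive_re; trivial.
Qed.

(* With [W = (1 + z) / (1 - z)], [(1 + omega) / (1 - omega)] is
   [((1 + a) W + (1 - a) / W) / 2]. *)
Lemma omega_shear (a : R) (z W p : C) :
  W <> 0%C -> (W + 1)%C <> 0%C -> (1 + RtoC a * z)%C <> 0%C ->
  ((W + 1) * z = W - 1)%C ->
  (p + omega a z * p =
   (p - omega a z * p) * (RtoC ((1 + a) / 2) * W + RtoC ((1 - a) / 2) * / W))%C.
Proof.
  intros HW HW1 Hz E.
  assert (Ez : z = ((W - 1) / (W + 1))%C) by (rewrite <- E; field; trivial).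
  subst z; unfold omega.
  rewrite !RtoC_div by lra; rewrite RtoC_plus, RtoC_minus. field.
  assert (N2 : RtoC 2 <> 0%C) by (intros E2; apply RtoC_inj in E2; lra).
  repeat split; trivial.
  intros E2; apply Hz.
  replace (1 + a * ((W - 1) / (W + 1)))%C with ((W + 1 + a * (W - 1)) * / (W + 1))%C
    by (field; trivial).
  rewrite E2. ring.
Qed.

Lemma one_plus_mult_neq_0 (a : R) (z : C) :
  -1 <= a <= 1 -> unit_disk z -> (1 + RtoC a * z)%C <> 0%C.
Proof.
  intros Ha Hz E. unfold unit_disk in Hz.
  assert (E1 : (RtoC a * z = - (1))%C) by (rewrite <- (Cplus_0_r (- (1)))%C, <- E; ring).
  apply (f_equal Cmod) in E1. rewrite Cmod_opp, Cmod_mult, Cmod_R, Cmod_1 in E1.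
  assert (Rabs a <= 1) by (apply Rabs_le; lra). pose proof (Cmod_ge_0 z).
  pose proof (Rabs_pos a). nra.
Qed.

(** A positive Jacobian excludes [C_derive H z = 0], so the quotient in [dilatation] can be
    cleared. *)
Lemma C_derive_is_F (c a : R) (H G : C -> C) (z : C) :
  is_F c a H G -> unit_disk z -> C_derive G z = (omega a z * C_derive H z)%C.
Proof.
  intros (HS & _ & Hw) Hz. rewrite <- (Hw z Hz). unfold dilatation. field.
  intros E. pose proof (S_H0_sense_preserving _ _ HS z Hz) as J.
  unfold harmonic_jacobian in J. rewrite E, Cmod_0 in J.
  pose proof (pow2_ge_0 (Cmod (C_derive G z))). lra.
Qed.

(** Let [p] and [q] be the derivatives of [H] and [G] along the ray. Then [k_c] gives [p - q], the
    dilatation gives [q = omega p], and [omega_shear] turns both into [p + q], whose real part is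
    the derivative of [shear_re]. *)
Lemma is_derive_sum_along_ray (c a : R) (H G : C -> C) (x y s : R) :
  -1 <= a <= 1 -> is_F c a H G -> Rabs (s * y) < PI / 2 ->
  is_derive (fun s => Re (H (tanh_half (s * x) (s * y))) + Re (G (tanh_half (s * x) (s * y)))
     - shear_re c a (s * x) (s * y)) s 0.
Proof.
  intros Ha HF Hs.
  pose proof (cos_strip_pos _ Hs) as Hc.
  destruct (ex_derive_tanh_half_ray x y s Hs) as [[du' Hu] [dv' Hv]].
  set (du := du' : R); set (dv := dv' : R).
  change du' with du in Hu; change dv' with dv in Hv; clearbody du dv; clear du' dv'.
  pose proof (tanh_half_in_disk (s * x) (s * y) Hc) as Hz.
  pose proof (tanh_half_Cexp (s * x) (s * y) Hc) as HW.
  pose proof (C_derive_is_F c a H G _ HF Hz) as Hd.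
  pose proof HF as (HS & Hk & _).
  set (z := fun s : R => tanh_half (s * x) (s * y)) in *.
  assert (Ez : forall r, z r = (fst (z r), snd (z r))) by (intros r; apply surjective_pairing).
  assert (Dx : is_derive (fun r : R => r * x) s x) by (auto_derive; trivial; ring).
  assert (Dy : is_derive (fun r : R => r * y) s y) by (auto_derive; trivial; ring).
  assert (DH := C_derive_correct H (z s) 0%C (S_H0_holo_h _ _ HS _ Hz)).
  assert (DG := C_derive_correct G (z s) 0%C (S_H0_holo_g _ _ HS _ Hz)).
  change (tanh_half (s * x) (s * y)) with (z s) in Hd, HW, Hz.
  rewrite (Ez s) in DH at 1. rewrite (Ez s) in DG at 1.
  destruct (is_derive_C_path H _ _ s du dv _ Hu Hv DH) as [HR HI].
  destruct (is_derive_C_path G _ _ s du dv _ Hu Hv DG) as [GR GI].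
  rewrite Hd in GR, GI.
  set (p := (C_derive H (z s) * (du, dv))%C) in *.
  replace (omega a (z s) * C_derive H (z s) * (du, dv))%C with (omega a (z s) * p)%C in GR, GI
    by (unfold p; ring).
  set (q := (omega a (z s) * p)%C) in *.
  (* The formula for [H - G] holds only inside the strip, so it is differentiated on a neighbourhood
     of [s] that stays there. *)
  assert (Hloc : locally s (fun r : R => Rabs (r * y) < PI / 2)).
  { apply (continuous_comp (fun r : R => Rabs (r * y)) (fun t => t) s) with
      (P := fun t => t < PI / 2).
    - apply continuous_comp; [|apply continuous_Rabs].
      apply (continuous_mult (fun r : R => r) (fun _ => y)); [apply continuous_id|apply continuous_const].
    - apply continuous_id.
    - apply (open_lt (PI / 2)); trivial. }
  assert (Epq : (p - q)%C = (Cexp (c * (s * x), c * (s * y))%R * ((x, y) / 2))%C).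
  { apply injective_projections.
    - change (Re p - Re q = Re (Cexp (c * (s * x), c * (s * y))%R * ((x, y) / 2))%C).
      assert (D1 := is_derive_minus (V := R_NormedModule) _ _ s _ _ HR GR).
      assert (D2 := is_derive_scal _ s (/ 2) _
        (is_derive_exp_primitive_re c _ _ s _ _ Dx Dy)).
      apply is_derive_unique in D1. apply is_derive_unique in D2.
      change (Re p - Re q) with (minus (Re p : R_NormedModule) (Re q)). rewrite <- D1.
      transitivity (/ 2 * (exp (c * (s * x)) * (cos (c * (s * y)) * x - sin (c * (s * y)) * y))).
      + etransitivity; [|exact D2]. apply Derive_ext_loc.
        revert Hloc; apply filter_imp; intros r Hr.
        pose proof (Hk _ (tanh_half_in_disk (r * x) (r * y) (cos_strip_pos _ Hr))) as E.
        rewrite gen_koebe_tanh_half in E by trivial. apply (f_equal fst) in E.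
        rewrite <- surjective_pairing. simpl in E |- *. unfold Re, minus, plus, opp; simpl.
        unfold Rminus in E; rewrite E. unfold scal; simpl; unfold mult; simpl. field.
      + unfold Cexp, Re, Im; simpl. field.
    - change (Im p - Im q = Im (Cexp (c * (s * x), c * (s * y))%R * ((x, y) / 2))%C).
      assert (D1 := is_derive_minus (V := R_NormedModule) _ _ s _ _ HI GI).
      assert (D2 := is_derive_scal _ s (/ 2) _
        (is_derive_exp_primitive_im c _ _ s _ _ Dx Dy)).
      apply is_derive_unique in D1. apply is_derive_unique in D2.
      change (Im p - Im q) with (minus (Im p : R_NormedModule) (Im q)). rewrite <- D1.
      transitivity (/ 2 * (exp (c * (s * x)) * (sin (c * (s * y)) * x + cos (c * (s * y)) * y))).
      + etransitivity; [|exact D2]. apply Derive_ext_loc.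
        revert Hloc; apply filter_imp; intros r Hr.
        pose proof (Hk _ (tanh_half_in_disk (r * x) (r * y) (cos_strip_pos _ Hr))) as E.
        rewrite gen_koebe_tanh_half in E by trivial. apply (f_equal snd) in E.
        rewrite <- surjective_pairing. simpl in E |- *. unfold Im, minus, plus, opp; simpl.
        unfold Rminus in E; rewrite E. unfold scal; simpl; unfold mult; simpl. field.
      + unfold Cexp, Re, Im; simpl. field. }
  pose proof (omega_shear a (z s) _ p (Cexp_neq_0 (s * x, s * y)) (Cexp_plus_1_neq_0 _ _ Hc)
    (one_plus_mult_neq_0 a _ Ha Hz) HW) as Esum.
  fold q in Esum. rewrite Epq in Esum.
  replace (/ Cexp (s * x, s * y)%R)%C with (Cexp (- (s * x), - (s * y))%R) in Esum.
  2:{ assert (E1 : (Cexp (s * x, s * y)%R * Cexp (- (s * x), - (s * y))%R = 1)%C).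
      { rewrite <- Cexp_plus. unfold Cexp, Cplus, Re, Im; simpl.
        rewrite !Rplus_opp_r, exp_0, cos_0, sin_0. apply injective_projections; simpl; ring. }
      transitivity (/ Cexp (s * x, s * y)%R *
        (Cexp (s * x, s * y)%R * Cexp (- (s * x), - (s * y))%R))%C;
        [field; apply Cexp_neq_0|rewrite E1; ring]. }
  (* Multiplying [exp (c zeta)] by [W] or [1 / W] shifts the exponent to [c + 1] or [c - 1]. *)
  assert (Esum' : (p + q)%C =
    (RtoC ((1 + a) / 4) * (Cexp ((c + 1) * (s * x), (c + 1) * (s * y))%R * (x, y)) +
     RtoC ((1 - a) / 4) * (Cexp ((c - 1) * (s * x), (c - 1) * (s * y))%R * (x, y)))%C).
  { replace ((c + 1) * (s * x), (c + 1) * (s * y))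
      with ((c * (s * x), c * (s * y))%R + (s * x, s * y)%R)%C
      by (apply injective_projections; simpl; ring).
    replace ((c - 1) * (s * x), (c - 1) * (s * y))
      with ((c * (s * x), c * (s * y))%R + (- (s * x), - (s * y))%R)%C
      by (apply injective_projections; simpl; ring).
    rewrite !Cexp_plus, Esum, !RtoC_div by lra.
    replace (RtoC 4) with (RtoC 2 * RtoC 2)%C by (rewrite <- RtoC_mult; f_equal; lra).
    field. }
  apply (f_equal Re) in Esum'.
  assert (D := is_derive_minus (V := R_NormedModule) _ _ s _ _
    (is_derive_plus (V := R_NormedModule) _ _ s _ _ HR GR)
    (is_derive_shear_re c a _ _ s _ _ Dx Dy)).
  evar_last.
  - eapply is_derive_ext; [|exact D]. intros r; cbv beta. rewrite <- surjective_pairing; reflexivity.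
  - change (Re (p + q)%C) with (Re p + Re q) in Esum'. clearbody q; clearbody p.
    unfold minus, plus, opp; simpl; rewrite Esum'. unfold Cexp, Re, Im; simpl. ring.
Qed.

(** Conjugating [G] makes the real part that of [H + G] and the imaginary part that of
    [H - G = k_c]. The former equals [shear_re] because their difference is constant along the ray
    from the origin, where both vanish. *)
Lemma harmonic_map_tanh_half (c a : R) (H G : C -> C) (x y : R) :
  -1 <= a <= 1 -> is_F c a H G -> Rabs y < PI / 2 ->
  harmonic_map H G (tanh_half x y) = (shear_re c a x y, exp_primitive_im c x y / 2).
Proof.
  intros Ha HF Hy.
  assert (Hray : forall s, 0 <= s <= 1 -> Rabs (s * y) < PI / 2).
  { intros s Hs. rewrite Rabs_mult, (Rabs_pos_eq s) by lra.
    pose proof (Rabs_pos y); nra. }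
  pose proof (eq_is_derive (V := R_NormedModule) _ 0 1
    (fun s Hs => is_derive_sum_along_ray c a H G x y s Ha HF (Hray s Hs)) Rlt_0_1) as E.
  cbv beta in E. rewrite !Rmult_0_l, !Rmult_1_l in E.
  pose proof HF as (HS & Hk & _).
  assert (T0 : tanh_half 0 0 = 0%C).
  { unfold tanh_half; rewrite exp_0, cos_0, sin_0.
    apply injective_projections; simpl; field. }
  rewrite T0, (S_H0_h0 _ _ HS), (S_H0_g0 _ _ HS) in E.
  assert (S0 : shear_re c a 0 0 = 0).
  { unfold shear_re, exp_primitive_re.
    destruct (Req_EM_T (c + 1) 0), (Req_EM_T (c - 1) 0);
      rewrite ?Rmult_0_r, ?exp_0, ?cos_0; field; trivial. split; trivial. }
  rewrite S0 in E. change (Re 0%C) with 0 in E.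
  pose proof (Hk _ (tanh_half_in_disk x y (cos_strip_pos _ Hy))) as Ek.
  rewrite gen_koebe_tanh_half in Ek by trivial. apply (f_equal snd) in Ek.
  apply injective_projections; unfold harmonic_map.
  - unfold Re in E. simpl in E |- *. lra.
  - simpl in Ek |- *. exact Ek.
Qed.

(** * Positivity and monotonicity on an interval *)

(** The weights are nonnegative with sum [1 / 2], so they never vanish together. *)
Lemma weighted_sum_pos (a p q : R) :
  -1 <= a <= 1 -> 0 < p -> 0 < q -> 0 < (1 + a) / 4 * p + (1 - a) / 4 * q.
Proof.
  intros Ha Hp Hq. destruct (Rle_dec a 0).
  - assert (0 <= (1 + a) * p) by nra. nra.
  - assert (0 <= (1 - a) * q) by nra. nra.
Qed.

Lemma continuity_pt_of_derive (r : R -> R) (s : R) : ex_derive r s -> continuity_pt r s.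
Proof.
  intros Hd; apply continuity_pt_filterlim.
  now apply (ex_derive_continuous (V := R_NormedModule)).
Qed.

(** The predicate [J] covers both parameter ranges needed later, the whole line and
    [(- PI / 2, 0)]. *)
Lemma strictly_increasing_of_derive (J : R -> Prop) (r : R -> R) (s t : R) :
  (forall s t u, J s -> J u -> s <= t <= u -> J t) ->
  (forall s, J s -> exists d, 0 < d /\ is_derive r s d) ->
  J s -> J t -> s < t -> r s < r t.
Proof.
  intros J_convex r_derive Hs Ht Hst.
  assert (HJ : forall u, s <= u <= t -> J u) by (intros u Hu; apply (J_convex s u t); trivial).
  destruct (MVT_gen r s t (Derive r)) as (u & Hu & E).
  - rewrite Rmin_left, Rmax_right by lra; intros u Hu. apply Derive_correct.
    destruct (r_derive u (HJ u ltac:(lra))) as (d & _ & Hd); now exists d.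
  - rewrite Rmin_left, Rmax_right by lra; intros u Hu. apply continuity_pt_of_derive.
    destruct (r_derive u (HJ u Hu)) as (d & _ & Hd); now exists d.
  - rewrite Rmin_left, Rmax_right in Hu by lra.
    destruct (r_derive u (HJ u Hu)) as (d & Hp & Hd).
    apply is_derive_unique in Hd. rewrite Hd in E. nra.
Qed.

Lemma intermediate_value (J : R -> Prop) (r : R -> R) (s t v : R) :
  (forall s t u, J s -> J u -> s <= t <= u -> J t) ->
  (forall s, J s -> exists d, 0 < d /\ is_derive r s d) ->
  J s -> J t -> r s <= v <= r t -> exists u, J u /\ r u = v.
Proof.
  intros J_convex r_derive Hs Ht [H1 H2].
  destruct (Req_dec (r s) v) as [E1|N1]; [now exists s|].
  destruct (Req_dec (r t) v) as [E2|N2]; [now exists t|].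
  (* The order of the parameters is forced by the order of the values. *)
  assert (Hst : s < t).
  { destruct (Rtotal_order s t) as [|[->|Hts]]; trivial; [lra|].
    pose proof (strictly_increasing_of_derive J r t s J_convex r_derive Ht Hs Hts); lra. }
  destruct (IVT_interv (fun u => r u - v) s t) as (u & Hu & E); trivial; try lra.
  - intros u Hu. apply continuity_pt_minus.
    + apply continuity_pt_of_derive.
      destruct (r_derive u (J_convex s u t Hs Ht Hu)) as (d & _ & Hd); now exists d.
    + apply continuity_pt_const; intros ??; trivial.
  - exists u; split; [apply (J_convex s u t); trivial|lra].
Qed.

(** * Level curves of the imaginary part *)

Lemma exp_primitive_re_opp (m x y : R) :
  exp_primitive_re m x (- y) = exp_primitive_re m x y.
Proof.
  unfold exp_primitive_re; destruct (Req_EM_T m 0); trivial.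
  now rewrite Ropp_mult_distr_r_reverse, cos_neg.
Qed.

Lemma exp_primitive_im_opp (m x y : R) :
  exp_primitive_im m x (- y) = - exp_primitive_im m x y.
Proof.
  unfold exp_primitive_im; destruct (Req_EM_T m 0); trivial.
  rewrite Ropp_mult_distr_r_reverse, sin_neg; field; trivial.
Qed.

Lemma exp_primitive_im_0_r (m x : R) : exp_primitive_im m x 0 = 0.
Proof.
  unfold exp_primitive_im; destruct (Req_EM_T m 0); trivial.
  rewrite Rmult_0_r, sin_0; field; trivial.
Qed.

(** As [c <= 2], the angle [c * y] stays in [(0, PI)], where sine is positive. *)
Lemma exp_primitive_im_pos (c x y : R) :
  0 <= c <= 2 -> 0 < y < PI / 2 -> 0 < exp_primitive_im c x y.
Proof.
  intros Hc Hy; unfold exp_primitive_im; destruct (Req_EM_T c 0) as [->|Hc0]; [lra|].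
  apply Rdiv_lt_0_compat; [|lra]. apply Rmult_lt_0_compat; [apply exp_pos|].
  apply sin_gt_0; nra.
Qed.

Lemma exp_primitive_im_sign (c x y : R) :
  0 <= c <= 2 -> Rabs y < PI / 2 ->
  (0 < exp_primitive_im c x y <-> 0 < y) /\ (exp_primitive_im c x y = 0 <-> y = 0).
Proof.
  intros Hc Hy; apply Rabs_def2 in Hy.
  destruct (Rtotal_order y 0) as [H|[->|H]].
  - pose proof (exp_primitive_im_pos c x (- y) Hc ltac:(lra)) as P.
    rewrite exp_primitive_im_opp in P. split; split; lra.
  - rewrite exp_primitive_im_0_r; split; split; lra.
  - pose proof (exp_primitive_im_pos c x y Hc ltac:(lra)) as P. split; split; lra.
Qed.

Lemma shear_re_opp (c a x y : R) : shear_re c a x (- y) = shear_re c a x y.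
Proof. unfold shear_re; now rewrite !exp_primitive_re_opp. Qed.

(* A parametrization [(X, Y)] over [J] of the level set of [exp_primitive_im c] through
   [(x0, y0)] in the strip, along which [shear_re c a] increases. *)
Record level_curve (c a x0 y0 : R) (J : R -> Prop) (X Y : R -> R) : Prop := {
  level_convex : forall s t u, J s -> J u -> s <= t <= u -> J t;
  level_open : forall s, J s -> exists s1 s2, J s1 /\ J s2 /\ s1 < s < s2;
  level_sound : forall s, J s -> Rabs (Y s) < PI / 2 /\
    exp_primitive_im c (X s) (Y s) = exp_primitive_im c x0 y0;
  level_complete : forall x y, Rabs y < PI / 2 ->
    exp_primitive_im c x y = exp_primitive_im c x0 y0 ->
    exists s, J s /\ X s = x /\ Y s = y;
  level_derive : forall s, J s -> exists d, 0 < d /\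
    is_derive (fun s => shear_re c a (X s) (Y s)) s d
}.

(** For [c = 0] the level function is [y] itself; for [y0 = 0] the level is [0], attained only on
    the real axis. Either way the level set is a horizontal line. *)
Lemma level_curve_horizontal (c a x0 y0 : R) :
  0 <= c <= 2 -> -1 <= a <= 1 -> Rabs y0 < PI / 2 -> c = 0 \/ y0 = 0 ->
  level_curve c a x0 y0 (fun _ => True) (fun s => s) (fun _ => y0).
Proof.
  intros Hc Ha Hy0 Hcase; split; trivial.
  - intros s _; exists (s - 1), (s + 1); repeat split; trivial; lra.
  - intros s _; split; trivial. destruct Hcase as [->| ->].
    + unfold exp_primitive_im; destruct (Req_EM_T 0 0); [trivial|lra].
    + now rewrite !exp_primitive_im_0_r.
  - intros x y Hy E; exists x; repeat split; trivial. destruct Hcase as [->| ->].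
    + unfold exp_primitive_im in E; destruct (Req_EM_T 0 0); [auto|lra].
    + rewrite exp_primitive_im_0_r in E.
      symmetry; apply (exp_primitive_im_sign c x y Hc Hy); trivial.
  - intros s _. eexists; split; [|apply is_derive_shear_re;
      [exact (is_derive_id (K := R_AbsRing) s)|exact (is_derive_const (V := R_NormedModule) y0 s)]].
    change (@one R_AbsRing) with 1; change (@zero R_NormedModule) with 0.
    rewrite !Rmult_0_r, !Rminus_0_r, !Rmult_1_r.
    assert (E : cos ((c + 1) * y0) = cos y0 /\ cos ((c - 1) * y0) = cos y0).
    { destruct Hcase as [->| ->]; [|now rewrite !Rmult_0_r].
      split; [f_equal; ring|]. rewrite <- (cos_neg y0). f_equal; ring. }
    destruct E as [-> ->]. pose proof (cos_strip_pos y0 Hy0).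
    pose proof (exp_pos ((c + 1) * s)); pose proof (exp_pos ((c - 1) * s)).
    apply weighted_sum_pos; nra.
Qed.

(** The equation [exp (c x) sin (c y) = c I] is solved for [x] as a function of [y]. The parameter
    is [s = - y] because [shear_re] decreases along the curve as [y] grows. *)
Lemma level_curve_upper (c a x0 y0 : R) :
  0 < c <= 2 -> -1 <= a <= 1 -> 0 < y0 < PI / 2 ->
  level_curve c a x0 y0 (fun s => - (PI / 2) < s < 0)
    (fun s => ln (c * exp_primitive_im c x0 y0 / sin (- (c * s))) / c) (fun s => - s).
Proof.
  intros Hc Ha Hy0.
  pose proof (exp_primitive_im_pos c x0 y0 ltac:(lra) Hy0) as HI.
  set (I := exp_primitive_im c x0 y0) in *.
  assert (Hsin : forall s, - (PI / 2) < s < 0 -> 0 < sin (- (c * s))).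
  { intros s Hs; apply sin_gt_0; nra. }
  assert (HcI : 0 < c * I) by nra.
  assert (Him : forall x y, exp_primitive_im c x y = exp (c * x) * sin (c * y) / c).
  { intros x y; unfold exp_primitive_im; destruct (Req_EM_T c 0); [lra|trivial]. }
  split.
  - intros; lra.
  - intros s Hs; exists ((s - PI / 2) / 2), (s / 2); lra.
  - intros s Hs; split; [apply Rabs_def1; lra|].
    pose proof (Hsin s Hs). fold I. rewrite Him, Ropp_mult_distr_r_reverse.
    replace (c * (ln (c * I / sin (- (c * s))) / c)) with (ln (c * I / sin (- (c * s))))
      by (field; lra).
    rewrite exp_ln by (apply Rdiv_lt_0_compat; trivial). field; lra.
  - intros x y Hy E; fold I in E; exists (- y).
    assert (Hy' : 0 < y).
    { apply (exp_primitive_im_sign c x y ltac:(lra) Hy). rewrite E; trivial. }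
    apply Rabs_def2 in Hy. split; [lra|]. split; [|ring].
    pose proof (Hsin (- y) ltac:(lra)) as P.
    rewrite <- E, Him.
    rewrite Ropp_mult_distr_r_reverse, Ropp_involutive in P |- *.
    replace (c * (exp (c * x) * sin (c * y) / c) / sin (c * y)) with (exp (c * x))
      by (field; lra).
    rewrite ln_exp; field; lra.
  - intros s Hs. pose proof (Hsin s Hs) as P.
    assert (DX : is_derive (fun s => ln (c * I / sin (- (c * s))) / c) s
       (cos (- (c * s)) / sin (- (c * s)))).
    { auto_derive.
      - split; [lra|]. split; [apply Rdiv_lt_0_compat; trivial|lra].
      - field. lra. }
    assert (DY : is_derive (fun s => - s) s (- 1)) by (auto_derive; trivial).
    eexists; split; [|exact (is_derive_shear_re c a _ _ s _ _ DX DY)].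
    cbv beta. set (X := ln _ / c). set (S := sin (- (c * s))) in *. set (K := cos (- (c * s))).
    assert (Hcos : 0 < cos (- s)) by (apply cos_gt_0; lra).
    (* By the cosine subtraction formula both exponents, [c + 1] and [c - 1], give the same positive
       factor [cos y / sin (c y)], with [y = - s]. *)
    assert (E1 : cos ((c + 1) * - s) * (K / S) - sin ((c + 1) * - s) * -1 = cos (- s) / S).
    { replace (cos (- s)) with (cos ((c + 1) * - s) * K + sin ((c + 1) * - s) * S).
      - field; lra.
      - unfold K, S; rewrite <- cos_minus; f_equal; ring. }
    assert (E2 : cos ((c - 1) * - s) * (K / S) - sin ((c - 1) * - s) * -1 = cos (- s) / S).
    { replace (cos (- s)) with (cos ((c - 1) * - s) * K + sin ((c - 1) * - s) * S).
      - field; lra.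
      - unfold K, S; rewrite <- cos_minus, <- (cos_neg (- s)); f_equal; ring. }
    rewrite E1, E2.
    assert (0 < cos (- s) / S) by (apply Rdiv_lt_0_compat; trivial).
    pose proof (exp_pos ((c + 1) * X)); pose proof (exp_pos ((c - 1) * X)).
    apply weighted_sum_pos; nra.
Qed.

(** Reflection in the real axis negates the imaginary part and fixes [shear_re], so it carries level
    curves to level curves with the same orientation. *)
Lemma level_curve_conj (c a x0 y0 : R) (J : R -> Prop) (X Y : R -> R) :
  level_curve c a x0 (- y0) J X Y -> level_curve c a x0 y0 J X (fun s => - Y s).
Proof.
  intros [L1 L2 L3 L4 L5]; split; trivial.
  - intros s Hs; destruct (L3 s Hs) as [Hy E].
    rewrite exp_primitive_im_opp in E |- *. rewrite Rabs_Ropp. split; trivial; lra.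
  - intros x y Hy E. rewrite exp_primitive_im_opp in L4.
    destruct (L4 x (- y)) as (s & Hs & EX & EY).
    + now rewrite Rabs_Ropp.
    + rewrite exp_primitive_im_opp; lra.
    + exists s; repeat split; trivial; lra.
  - intros s Hs; destruct (L5 s Hs) as (d & Hd & D); exists d; split; trivial.
    apply (is_derive_ext (fun s => shear_re c a (X s) (Y s))); trivial.
    intros t; now rewrite shear_re_opp.
Qed.

Lemma level_curve_exists (c a x0 y0 : R) :
  0 <= c <= 2 -> -1 <= a <= 1 -> Rabs y0 < PI / 2 ->
  exists J X Y, level_curve c a x0 y0 J X Y.
Proof.
  intros Hc Ha Hy.
  destruct (Req_dec c 0) as [H|H]; [do 3 eexists; apply level_curve_horizontal; auto|].
  destruct (Req_dec y0 0) as [H'|H']; [do 3 eexists; apply level_curve_horizontal; auto|].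
  pose proof (Rabs_def2 _ _ Hy).
  destruct (Rlt_dec 0 y0).
  - do 3 eexists; apply level_curve_upper; lra.
  - do 3 eexists; apply level_curve_conj, level_curve_upper; lra.
Qed.

(** * Horizontal sections and openness of the image *)

Definition shear_image (c a : R) (w : C) : Prop :=
  exists x y, Rabs y < PI / 2 /\ w = (shear_re c a x y, exp_primitive_im c x y / 2).

Lemma image_is_F (c a : R) (H G : C -> C) :
  -1 <= a <= 1 -> is_F c a H G ->
  set_eq (image (harmonic_map H G) unit_disk) (shear_image c a).
Proof.
  intros Ha HF w; split.
  - intros (z & Hz & <-). destruct (tanh_half_onto_disk z Hz) as (x & y & Hy & <-).
    exists x, y; split; trivial. now apply harmonic_map_tanh_half.
  - intros (x & y & Hy & ->). exists (tanh_half x y); split.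
    + now apply tanh_half_in_disk, cos_strip_pos.
    + now apply harmonic_map_tanh_half.
Qed.

(** Both points lie on one level curve, and the intermediate value theorem along it fills the
    segment between their images. *)
Lemma shear_image_section (c a x1 y1 x2 y2 u : R) :
  0 <= c <= 2 -> -1 <= a <= 1 -> Rabs y1 < PI / 2 -> Rabs y2 < PI / 2 ->
  exp_primitive_im c x2 y2 = exp_primitive_im c x1 y1 ->
  shear_re c a x1 y1 <= u <= shear_re c a x2 y2 ->
  shear_image c a (u, exp_primitive_im c x1 y1 / 2).
Proof.
  intros Hc Ha Hy1 Hy2 E Hu.
  destruct (level_curve_exists c a x1 y1 Hc Ha Hy1) as (J & X & Y & L).
  destruct (level_complete _ _ _ _ _ _ _ L x1 y1 Hy1 eq_refl) as (s1 & J1 & <- & <-).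
  destruct (level_complete _ _ _ _ _ _ _ L x2 y2 Hy2 E) as (s2 & J2 & <- & <-).
  destruct (intermediate_value J _ s1 s2 u (level_convex _ _ _ _ _ _ _ L)
    (level_derive _ _ _ _ _ _ _ L) J1 J2 Hu) as (s & Js & Es).
  destruct (level_sound _ _ _ _ _ _ _ L s Js) as [Hy EI].
  exists (X s), (Y s); split; trivial. now rewrite <- Es, EI.
Qed.

Lemma shear_image_neighbours (c a x0 y0 : R) :
  0 <= c <= 2 -> -1 <= a <= 1 -> Rabs y0 < PI / 2 ->
  exists x1 y1 x2 y2, Rabs y1 < PI / 2 /\ Rabs y2 < PI / 2 /\
    exp_primitive_im c x1 y1 = exp_primitive_im c x0 y0 /\
    exp_primitive_im c x2 y2 = exp_primitive_im c x0 y0 /\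
    shear_re c a x1 y1 < shear_re c a x0 y0 < shear_re c a x2 y2.
Proof.
  intros Hc Ha Hy0.
  destruct (level_curve_exists c a x0 y0 Hc Ha Hy0) as (J & X & Y & L).
  destruct (level_complete _ _ _ _ _ _ _ L x0 y0 Hy0 eq_refl) as (s & Js & EX & EY).
  destruct (level_open _ _ _ _ _ _ _ L s Js) as (s1 & s2 & J1 & J2 & Hs).
  destruct (level_sound _ _ _ _ _ _ _ L s1 J1) as [Hy1 E1].
  destruct (level_sound _ _ _ _ _ _ _ L s2 J2) as [Hy2 E2].
  exists (X s1), (Y s1), (X s2), (Y s2); repeat split; trivial; rewrite <- EX, <- EY.
  - apply (strictly_increasing_of_derive J (fun s => shear_re c a (X s) (Y s)) s1 s
      (level_convex _ _ _ _ _ _ _ L) (level_derive _ _ _ _ _ _ _ L)); trivial; lra.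
  - apply (strictly_increasing_of_derive J (fun s => shear_re c a (X s) (Y s)) s s2
      (level_convex _ _ _ _ _ _ _ L) (level_derive _ _ _ _ _ _ _ L)); trivial; lra.
Qed.

(* Along the direction [(sin (c y1), cos (c y1))] the derivative of [exp_primitive_im c]
   at [(x1, y1)] is [exp (c x1) > 0], so nearby heights are attained nearby. *)
Lemma shear_local_lift (c a x1 y1 eps : R) :
  Rabs y1 < PI / 2 -> 0 < eps ->
  exists del, 0 < del /\ forall t, Rabs (t - exp_primitive_im c x1 y1) < del ->
  exists x y, Rabs y < PI / 2 /\ exp_primitive_im c x y = t /\
    Rabs (shear_re c a x y - shear_re c a x1 y1) < eps.
Proof.
  intros Hy He.
  set (X := fun s => x1 + s * sin (c * y1)). set (Y := fun s => y1 + s * cos (c * y1)).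
  assert (DX : forall s, is_derive X s (sin (c * y1))) by (intros; unfold X; auto_derive; trivial; ring).
  assert (DY : forall s, is_derive Y s (cos (c * y1))) by (intros; unfold Y; auto_derive; trivial; ring).
  assert (X0 : X 0 = x1) by (unfold X; ring). assert (Y0 : Y 0 = y1) by (unfold Y; ring).
  set (g := fun s => exp_primitive_im c (X s) (Y s)).
  assert (Dg : forall s, ex_derive g s).
  { intros s; eexists; apply is_derive_exp_primitive_im; [apply DX|apply DY]. }
  assert (Dg0 : is_derive g 0 (exp (c * x1))).
  { evar_last; [apply is_derive_exp_primitive_im; [apply DX|apply DY]|].
    rewrite X0, Y0. pose proof (sin2_cos2 (c * y1)) as S; unfold Rsqr in S; rewrite S; ring. }
  set (r := fun s => shear_re c a (X s) (Y s)).
  assert (Cr : continuous r 0).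
  { apply (ex_derive_continuous (V := R_NormedModule)).
    eexists; apply is_derive_shear_re; [apply DX|apply DY]. }
  assert (CY : continuous (fun s => Rabs (Y s)) 0).
  { apply continuous_comp; [|apply continuous_Rabs].
    apply (ex_derive_continuous (V := R_NormedModule)); eexists; apply DY. }
  assert (L1 : locally 0 (fun s => Rabs (Y s) < PI / 2)).
  { apply (CY (fun t => t < PI / 2)). apply (open_lt (PI / 2)). now rewrite Y0. }
  assert (L2 : locally 0 (fun s => Rabs (r s - r 0) < eps)).
  { apply (Cr (fun t => Rabs (t - r 0) < eps)). exists (mkposreal _ He); intros t Ht; exact Ht. }
  (* An error of at most half the slope makes [g] move by at least half the slope times [h] on each
     side, so all heights in that range are reached. *)
  assert (L3 : locally 0 (fun s => Rabs (g s - g 0 - s * exp (c * x1)) <= exp (c * x1) / 2 * Rabs s)).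
  { destruct Dg0 as [_ Dg0].
    assert (Hp : 0 < exp (c * x1) / 2) by (pose proof (exp_pos (c * x1)); lra).
    specialize (Dg0 0 (fun P HP => HP) (mkposreal _ Hp)).
    revert Dg0; apply filter_imp; intros s.
    unfold norm, minus, plus, opp, scal; simpl; unfold abs, mult; simpl.
    rewrite Ropp_0, Rplus_0_r. trivial. }
  destruct (filter_and _ _ L1 (filter_and _ _ L2 L3)) as [d Hd].
  pose proof (cond_pos d) as Hdp. set (h := d / 2). assert (Hh : 0 < h < d) by (unfold h; lra).
  assert (Hin : forall s, -h <= s <= h -> ball 0 d s).
  { intros s Hs. change (Rabs (s - 0) < d). apply Rabs_def1; lra. }
  pose proof (exp_pos (c * x1)) as Hex.
  assert (Hlo : g (- h) <= g 0 - exp (c * x1) / 2 * h).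
  { destruct (Hd (- h) (Hin (- h) ltac:(lra))) as (_ & _ & B).
    rewrite (Rabs_left (- h)) in B by lra. apply Rabs_le_between in B. lra. }
  assert (Hhi : g 0 + exp (c * x1) / 2 * h <= g h).
  { destruct (Hd h (Hin h ltac:(lra))) as (_ & _ & B).
    rewrite (Rabs_pos_eq h) in B by lra. apply Rabs_le_between in B. lra. }
  assert (Eg0 : g 0 = exp_primitive_im c x1 y1) by (unfold g; now rewrite X0, Y0).
  assert (Er0 : r 0 = shear_re c a x1 y1) by (unfold r; now rewrite X0, Y0).
  exists (exp (c * x1) / 2 * h). split; [nra|]. rewrite <- Eg0, <- Er0; intros t Ht.
  apply Rabs_def2 in Ht.
  destruct (IVT_gen g (- h) h t) as (s & Hs & Es).
  - intros s; apply continuity_pt_of_derive, Dg.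
  - assert (0 < exp (c * x1) / 2 * h) by nra. rewrite Rmin_left, Rmax_right by lra. lra.
  - rewrite Rmin_left, Rmax_right in Hs by lra.
    destruct (Hd s (Hin s Hs)) as (HY & Hr & _).
    exists (X s), (Y s); repeat split; trivial.
Qed.

(** Image points strictly left and right of the given one lift to all nearby heights with small
    horizontal error; at each such height [shear_image_section] fills the gap. *)
Lemma shear_image_open (c a : R) :
  0 <= c <= 2 -> -1 <= a <= 1 -> open (T := C_UniformSpace) (shear_image c a).
Proof.
  intros Hc Ha w (x0 & y0 & Hy0 & ->).
  destruct (shear_image_neighbours c a x0 y0 Hc Ha Hy0)
    as (x1 & y1 & x2 & y2 & Hy1 & Hy2 & E1 & E2 & Hr).
  set (u0 := shear_re c a x0 y0) in *.
  set (u1 := shear_re c a x1 y1) in *. set (u2 := shear_re c a x2 y2) in *.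
  destruct (shear_local_lift c a x1 y1 ((u0 - u1) / 2) Hy1 ltac:(lra)) as (d1 & Hd1 & L1).
  destruct (shear_local_lift c a x2 y2 ((u2 - u0) / 2) Hy2 ltac:(lra)) as (d2 & Hd2 & L2).
  fold u1 in L1; fold u2 in L2. rewrite E1 in L1; rewrite E2 in L2.
  (* [d1] and [d2] are halved since the imaginary coordinate is half of [exp_primitive_im]; the half
     gaps keep [u] between the lifted endpoints. *)
  set (e := Rmin (Rmin (d1 / 2) (d2 / 2)) (Rmin ((u0 - u1) / 2) ((u2 - u0) / 2))).
  assert (He : 0 < e) by (unfold e; repeat apply Rmin_glb_lt; lra).
  assert (He1 : e <= d1 / 2 /\ e <= d2 / 2 /\ e <= (u0 - u1) / 2 /\ e <= (u2 - u0) / 2).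
  { unfold e. pose proof (Rmin_l (Rmin (d1 / 2) (d2 / 2)) (Rmin ((u0 - u1) / 2) ((u2 - u0) / 2))).
    pose proof (Rmin_r (Rmin (d1 / 2) (d2 / 2)) (Rmin ((u0 - u1) / 2) ((u2 - u0) / 2))).
    pose proof (Rmin_l (d1 / 2) (d2 / 2)). pose proof (Rmin_r (d1 / 2) (d2 / 2)).
    pose proof (Rmin_l ((u0 - u1) / 2) ((u2 - u0) / 2)).
    pose proof (Rmin_r ((u0 - u1) / 2) ((u2 - u0) / 2)). lra. }
  exists (mkposreal e He). intros [u t] [Bu Bt].
  change (Rabs (u - u0) < e) in Bu.
  change (Rabs (t - exp_primitive_im c x0 y0 / 2) < e) in Bt.
  apply Rabs_def2 in Bu; apply Rabs_def2 in Bt.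
  destruct (L1 (2 * t)) as (x1' & y1' & Hy1' & E1' & B1); [apply Rabs_def1; lra|].
  destruct (L2 (2 * t)) as (x2' & y2' & Hy2' & E2' & B2); [apply Rabs_def1; lra|].
  apply Rabs_def2 in B1; apply Rabs_def2 in B2.
  replace t with (exp_primitive_im c x1' y1' / 2) by lra.
  apply (shear_image_section c a x1' y1' x2' y2'); trivial; lra.
Qed.

(** * Connectedness and horizontal convexity *)

Lemma continuous_pair (f g : R -> R) (t : R) :
  continuous f t -> continuous g t ->
  continuous (T := R_UniformSpace) (U := C_UniformSpace) (fun s => (f s, g s)) t.
Proof.
  intros Hf Hg; apply filterlim_locally; intros eps.
  apply filter_and; [exact (proj1 (filterlim_locally _ _) Hf eps)|
    exact (proj1 (filterlim_locally _ _) Hg eps)].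
Qed.

(** Let [m] be the supremum of the times up to which the path stays in [U]. If [p m] is in [U], then
    [m = 1] and the endpoint lies in both sets; if it is in [V], points of the path at times just
    before [m], or at [m], do. *)
Lemma path_connected_connected (A : C -> Prop) :
  (forall w1 w2, A w1 -> A w2 -> exists p : R -> C,
     (forall t, continuous (T := R_UniformSpace) (U := C_UniformSpace) p t) /\
     p 0 = w1 /\ p 1 = w2 /\ forall t, 0 <= t <= 1 -> A (p t)) ->
  connected A.
Proof.
  intros HA U V HU HV HUV (w1 & A1 & U1) (w2 & A2 & V2).
  destruct (HA w1 w2 A1 A2) as (p & Hc & P0 & P1 & HpA).
  set (E := fun t => 0 <= t <= 1 /\ forall s, 0 <= s <= t -> U (p s)).
  assert (E0 : E 0).
  { split; [lra|]. intros s Hs; replace s with 0 by lra; now rewrite P0. }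
  destruct (completeness E) as [m [Hub Hlub]].
  { exists 1; intros t Ht; apply Ht. }
  { now exists 0. }
  assert (Hm : 0 <= m <= 1).
  { split; [now apply Hub|apply Hlub; intros t Ht; apply Ht]. }
  assert (Happ : forall d, 0 < d -> exists t, E t /\ m - d < t <= m).
  { intros d Hd. apply NNPP; intros N.
    assert (m <= m - d); [|lra].
    apply Hlub; intros t Ht. apply Rnot_lt_le; intros Hlt. apply N; exists t.
    pose proof (Hub t Ht). split; [trivial|lra]. }
  destruct (HUV (p m) (HpA m Hm)) as [Um|Vm].
  - destruct (Hc m U (HU _ Um)) as [d Hd].
    destruct (Happ d (cond_pos d)) as (t & [_ Ht] & Htm).
    assert (Em : E (Rmin (m + d / 2) 1)).
    { pose proof (cond_pos d). pose proof (Rmin_l (m + d / 2) 1). pose proof (Rmin_r (m + d / 2) 1).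
      assert (0 <= Rmin (m + d / 2) 1) by (apply Rmin_glb; lra).
      split; [lra|]. intros s Hs.
      destruct (Rle_dec s t); [apply Ht; lra|].
      apply Hd. change (Rabs (s - m) < d). apply Rabs_def1; lra. }
    apply Hub in Em. pose proof (cond_pos d).
    destruct (Rle_dec 1 (m + d / 2)); [rewrite Rmin_right in Em by lra|rewrite Rmin_left in Em; lra].
    exists (p 1). rewrite P1. replace m with 1 in Um by lra. rewrite P1 in Um. auto.
  - destruct (Hc m V (HV _ Vm)) as [d Hd].
    destruct (Happ d (cond_pos d)) as (t & [Ht0 Ht] & Htm).
    exists (p t). split; [apply HpA; lra|]. split; [apply Ht; lra|].
    apply Hd. change (Rabs (t - m) < d). apply Rabs_def1; lra.
Qed.

Lemma strip_convex (y1 y2 t : R) :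
  Rabs y1 < PI / 2 -> Rabs y2 < PI / 2 -> 0 <= t <= 1 -> Rabs (y1 + t * (y2 - y1)) < PI / 2.
Proof.
  intros H1 H2 Ht. set (m := Rmax (Rabs y1) (Rabs y2)).
  apply Rle_lt_trans with m; [|now apply Rmax_lub_lt].
  pose proof (Rmax_l (Rabs y1) (Rabs y2)) as M1; pose proof (Rmax_r (Rabs y1) (Rabs y2)) as M2.
  fold m in M1, M2. apply Rabs_le_between in M1; apply Rabs_le_between in M2.
  apply Rabs_le; nra.
Qed.

Lemma shear_image_connected (c a : R) : connected (shear_image c a).
Proof.
  apply path_connected_connected; intros w1 w2 (x1 & y1 & Hy1 & ->) (x2 & y2 & Hy2 & ->).
  set (X := fun t => x1 + t * (x2 - x1)). set (Y := fun t => y1 + t * (y2 - y1)).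
  assert (DX : forall s, is_derive X s (x2 - x1)) by (intros; unfold X; auto_derive; trivial; ring).
  assert (DY : forall s, is_derive Y s (y2 - y1)) by (intros; unfold Y; auto_derive; trivial; ring).
  exists (fun t => (shear_re c a (X t) (Y t), exp_primitive_im c (X t) (Y t) / 2)).
  repeat split.
  - intros t; apply continuous_pair; apply (ex_derive_continuous (V := R_NormedModule)).
    + eexists; apply is_derive_shear_re; [apply DX|apply DY].
    + apply (ex_derive_ext (fun t => / 2 * exp_primitive_im c (X t) (Y t)));
        [intros s; apply Rmult_comm|].
      apply ex_derive_scal. eexists; apply is_derive_exp_primitive_im; [apply DX|apply DY].
  - unfold X, Y; now rewrite !Rmult_0_l, !Rplus_0_r.
  - unfold X, Y. now replace (x1 + 1 * (x2 - x1)) with x2 by ring; replace (y1 + 1 * (y2 - y1)) with y2 by ring.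
  - intros t Ht; exists (X t), (Y t); split; trivial. now apply strip_convex.
Qed.

Lemma shear_image_horizontally_convex (c a : R) :
  0 <= c <= 2 -> -1 <= a <= 1 -> convex_in_horizontal_direction (shear_image c a).
Proof.
  intros Hc Ha; split; [split; [|split]|].
  - exists (shear_re c a 0 0, exp_primitive_im c 0 0 / 2), 0, 0; split; trivial.
    rewrite Rabs_R0; pose proof PI_RGT_0; lra.
  - now apply shear_image_open.
  - apply shear_image_connected.
  - intros y; apply path_connected_connected.
    intros [u1 v1] [u2 v2] [A1 E1] [A2 E2]; simpl in E1, E2; subst v1 v2.
    exists (fun t => (u1 + t * (u2 - u1), y)); repeat split.
    + intros t; apply continuous_pair; [|apply continuous_const].
      apply (ex_derive_continuous (V := R_NormedModule)); auto_derive; trivial.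
    + f_equal; ring.
    + f_equal; ring.
    + destruct A1 as (x1 & y1 & Hy1 & P1), A2 as (x2 & y2 & Hy2 & P2).
      injection P1 as -> P1. injection P2 as -> P2.
      destruct (Rle_dec (shear_re c a x1 y1) (shear_re c a x2 y2)) as [Hle|Hle].
      * rewrite P1. apply (shear_image_section c a x1 y1 x2 y2); trivial; [lra|nra].
      * rewrite P2. apply (shear_image_section c a x2 y2 x1 y1); trivial; [lra|nra].
Qed.

(** * The case [c = 0] *)

Lemma shear_re_strip (a x y : R) :
  shear_re 0 a x y =
  (1 + a) / 4 * (exp x * cos y - 1) - (1 - a) / 4 * (/ exp x * cos y - 1).
Proof.
  unfold shear_re, exp_primitive_re.
  destruct (Req_EM_T (0 + 1) 0); [lra|]. destruct (Req_EM_T (0 - 1) 0); [lra|].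
  replace ((0 + 1) * x) with x by ring. replace ((0 + 1) * y) with y by ring.
  replace ((0 - 1) * x) with (- x) by ring. replace ((0 - 1) * y) with (- y) by ring.
  rewrite exp_Ropp, cos_neg. field. pose proof (exp_pos x); lra.
Qed.

Lemma exp_primitive_im_0_l (x y : R) : exp_primitive_im 0 x y = y.
Proof. unfold exp_primitive_im; destruct (Req_EM_T 0 0); lra. Qed.

(** Substitute [e = exp x * cos y] with [y = 2 Im w] fixed: [e] runs over all positive reals, and
    [exp (- x) * cos y] becomes [cos y ^ 2 / e]. *)
Lemma shear_image_strip (a : R) (w : C) :
  shear_image 0 a w <-> horizontal_strip w /\ exists e, 0 < e /\
    Re w = (1 + a) / 4 * (e - 1) - (1 - a) / 4 * (/ e * cos (2 * Im w) ^ 2 - 1).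
Proof.
  unfold horizontal_strip; split.
  - intros (x & y & Hy & ->). pose proof (cos_strip_pos y Hy) as Hc.
    pose proof (exp_pos x) as He.
    unfold Re, Im; cbn [fst snd]. rewrite exp_primitive_im_0_l, shear_re_strip. split.
    + apply Rabs_def2 in Hy; apply Rabs_def1; lra.
    + exists (exp x * cos y); split; [nra|].
      replace (2 * (y / 2)) with y by field. field. split; lra.
  - destruct w as [u t]; unfold Re, Im; cbn [fst snd]; intros (Ht & e & He & E).
    assert (Hy : Rabs (2 * t) < PI / 2).
    { apply Rabs_def2 in Ht; apply Rabs_def1; lra. }
    pose proof (cos_strip_pos _ Hy) as Hc.
    exists (ln (e / cos (2 * t))), (2 * t); split; trivial.
    rewrite exp_primitive_im_0_l, shear_re_strip, exp_ln by (apply Rdiv_lt_0_compat; trivial).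
    rewrite E. f_equal; field. split; lra.
Qed.

(* Multiplied by [e], the equation is quadratic with a negative constant term. *)
Lemma exp_combination_onto (p q v : R) :
  0 < p -> 0 < q -> exists e, 0 < e /\ p * e - q * / e = v.
Proof.
  intros Hp Hq. set (s := sqrt (v ^ 2 + 4 * p * q)).
  assert (Hpq : 0 < p * q) by nra.
  assert (Hs : s * s = v ^ 2 + 4 * p * q) by (apply sqrt_sqrt; nra).
  assert (Hs0 : 0 <= s) by apply sqrt_pos.
  assert (Hvs : 0 < v + s) by nra.
  exists ((v + s) / (2 * p)); split; [apply Rdiv_lt_0_compat; lra|].
  field_simplify_eq; [|lra]. nra.
Qed.

Lemma shear_image_strip_interior (a : R) :
  -1 < a < 1 -> set_eq (shear_image 0 a) horizontal_strip.
Proof.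
  intros Ha w; rewrite shear_image_strip; split; [tauto|]. intros Hw; split; trivial.
  assert (Hc : 0 < cos (2 * Im w)).
  { apply cos_strip_pos. unfold horizontal_strip in Hw.
    apply Rabs_def2 in Hw; apply Rabs_def1; lra. }
  destruct (exp_combination_onto ((1 + a) / 4) ((1 - a) / 4 * cos (2 * Im w) ^ 2)
    (Re w + (1 + a) / 4 - (1 - a) / 4)) as (e & He & E).
  - lra.
  - apply Rmult_lt_0_compat; [lra|]. now apply pow_lt.
  - exists e; split; trivial. lra.
Qed.

(** Only the growing exponential survives at [a = 1]: [Re w = (e - 1) / 2]. *)
Lemma shear_image_strip_right :
  set_eq (shear_image 0 1) (fun w => horizontal_strip w /\ - (1 / 2) < Re w).
Proof.
  intros w; rewrite shear_image_strip; split.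
  - intros (Hw & e & He & ->); split; trivial. lra.
  - intros (Hw & Hr); split; trivial. exists (2 * Re w + 1); split; lra.
Qed.

Lemma shear_image_strip_left :
  set_eq (shear_image 0 (-1)) (fun w => horizontal_strip w /\ Re w < 1 / 2).
Proof.
  intros w; rewrite shear_image_strip; unfold horizontal_strip; split.
  - intros (Hw & e & He & E); split; trivial.
    assert (Hc : 0 < cos (2 * Im w)).
    { apply cos_strip_pos. apply Rabs_def2 in Hw; apply Rabs_def1; lra. }
    assert (0 < / e * cos (2 * Im w) ^ 2).
    { apply Rmult_lt_0_compat; [now apply Rinv_0_lt_compat|now apply pow_lt]. }
    lra.
  - intros (Hw & Hr); split; trivial.
    assert (Hc : 0 < cos (2 * Im w)).
    { apply cos_strip_pos. apply Rabs_def2 in Hw; apply Rabs_def1; lra. }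
    (* At [a = -1] the equation reads [1 - 2 Re w = cos (2 Im w) ^ 2 / e]. *)
    exists (cos (2 * Im w) ^ 2 / (1 - 2 * Re w)); split.
    + apply Rdiv_lt_0_compat; [now apply pow_lt|lra].
    + field. split; lra.
Qed.

(** * The case [c = 2] *)

(** Here [p + i q] is [W], running over the right half-plane; the cubic bracket is [Re (W^3 - 1)],
    and [Im (W^2) = 2 p q]. *)
Lemma shear_image_slit (a : R) (w : C) :
  shear_image 2 a w <-> exists p q, 0 < p /\
    Re w = (1 + a) / 12 * (p ^ 3 - 3 * p * q ^ 2 - 1) + (1 - a) / 4 * (p - 1) /\
    Im w = p * q / 2.
Proof.
  assert (F : forall x y p q, Cexp (x, y) = (p, q) ->
    shear_re 2 a x y = (1 + a) / 12 * (p ^ 3 - 3 * p * q ^ 2 - 1) + (1 - a) / 4 * (p - 1) /\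
    exp_primitive_im 2 x y / 2 = p * q / 2).
  { intros x y p q E. unfold shear_re, exp_primitive_re, exp_primitive_im.
    destruct (Req_EM_T (2 + 1) 0); [lra|]. destruct (Req_EM_T (2 - 1) 0); [lra|].
    destruct (Req_EM_T 2 0); [lra|].
    assert (E2 : Cexp (2 * x, 2 * y)%R = ((p, q) * (p, q))%C).
    { rewrite <- E, <- Cexp_plus. f_equal; apply injective_projections; simpl; ring. }
    assert (E3 : Cexp ((2 + 1) * x, (2 + 1) * y)%R = ((p, q) * ((p, q) * (p, q)))%C).
    { rewrite <- E2, <- E, <- Cexp_plus. f_equal; apply injective_projections; simpl; ring. }
    replace ((2 - 1) * x) with x by ring. replace ((2 - 1) * y) with y by ring.
    apply (f_equal fst) in E. apply (f_equal fst) in E3. apply (f_equal snd) in E2.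
    unfold Cexp, Re, Im in E, E2, E3. simpl in E, E2, E3. rewrite E, E2, E3.
    split; field. }
  split.
  - intros (x & y & Hy & ->). exists (exp x * cos y), (exp x * sin y).
    destruct (F x y _ _ eq_refl) as [E1 E2].
    split; [|split; trivial].
    apply Rmult_lt_0_compat; [apply exp_pos|now apply cos_strip_pos].
  - destruct w as [u t]; intros (p & q & Hp & E1 & E2).
    destruct (Cexp_onto_right_half_plane p q Hp) as (x & y & Hy & E).
    destruct (F x y p q E) as [F1 F2].
    exists x, y; split; trivial. rewrite F1, F2. now f_equal.
Qed.

Lemma shear_image_half_plane : set_eq (shear_image 2 (-1)) (fun w => - (1 / 2) < Re w).
Proof.
  intros w; rewrite shear_image_slit; split.
  - intros (p & q & Hp & -> & _). lra.
  - intros Hr. exists (2 * Re w + 1), (2 * Im w / (2 * Re w + 1)). repeat split; [lra|lra|].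
    field; lra.
Qed.

Lemma quartic_positive_root (k b v d : R) :
  (* The value at [0] is [- d]. As [M >= 1] and [k M = k + |v| + d], the leading term at [M]
     dominates [v M + d]. *)
  0 < k -> 0 <= b -> 0 < d -> exists p, 0 < p /\ k * p ^ 4 + b * p ^ 2 - v * p - d = 0.
Proof.
  intros Hk Hb Hd. set (M := 1 + (Rabs v + d) / k).
  pose proof (Rabs_pos v) as Hv. pose proof (Rle_abs v) as Hv'.
  assert (HM : k * M = k + Rabs v + d) by (unfold M; field; lra).
  assert (HM1 : 1 <= M).
  { unfold M. assert (0 < (Rabs v + d) / k) by (apply Rdiv_lt_0_compat; lra). lra. }
  destruct (IVT_interv (fun p => k * p ^ 4 + b * p ^ 2 - v * p - d) 0 M) as (p & Hp & E).
  - intros p _. apply continuity_pt_of_derive. auto_derive; trivial.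
  - lra.
  - simpl; lra.
  - assert (0 <= b * M ^ 2) by (apply Rmult_le_pos; trivial; apply pow2_ge_0).
    assert (k * M * 1 <= k * M * M ^ 2) by (apply Rmult_le_compat_l; nra).
    assert (k * M <= k * M ^ 3) by (replace (k * M ^ 3) with (k * M * M ^ 2) by ring; lra).
    replace (k * M ^ 4) with (k * M ^ 3 * M) by ring.
    assert ((k + Rabs v + d) * M <= k * M ^ 3 * M) by (apply Rmult_le_compat_r; lra).
    nra.
  - exists p; split; trivial. destruct (Req_dec p 0) as [->|]; [simpl in E; lra|lra].
Qed.

Lemma cubic_positive_root (k b v : R) :
  0 < k -> 0 <= b -> 0 < v -> exists p, 0 < p /\ k * p ^ 3 + b * p - v = 0.
Proof.
  intros Hk Hb Hv. set (M := 1 + v / k).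
  assert (HM : k * M = k + v) by (unfold M; field; lra).
  assert (HM1 : 1 <= M).
  { unfold M. assert (0 < v / k) by (apply Rdiv_lt_0_compat; lra). lra. }
  destruct (IVT_interv (fun p => k * p ^ 3 + b * p - v) 0 M) as (p & Hp & E).
  - intros p _. apply continuity_pt_of_derive. auto_derive; trivial.
  - lra.
  - simpl; lra.
  - assert (0 <= b * M) by nra.
    assert (k * M * 1 <= k * M * M ^ 2) by (apply Rmult_le_compat_l; nra).
    replace (k * M ^ 3) with (k * M * M ^ 2) by ring. lra.
  - exists p; split; trivial. destruct (Req_dec p 0) as [->|]; [simpl in E; lra|lra].
Qed.

(** On the real axis [q = 0], and an increasing cubic in [p] reaches exactly the points right of the
    slit tip. Off the axis [q = 2 t / p], and multiplying by [p] gives a quartic with negative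
    constant term, solvable for every [Re w]. *)
Lemma shear_image_slit_plane (a : R) :
  -1 < a <= 1 -> set_eq (shear_image 2 a) (slit_plane a).
Proof.
  intros Ha w; rewrite shear_image_slit; unfold slit_plane; split.
  - intros (p & q & Hp & E1 & E2) [N1 N2].
    rewrite E2 in N1. assert (Hq : q = 0) by nra. subst q.
    rewrite E1 in N2.
    assert (0 < (1 + a) / 12 * p ^ 3) by (apply Rmult_lt_0_compat; [lra|now apply pow_lt]).
    nra.
  - intros N. destruct (Req_dec (Im w) 0) as [E|E].
    + assert (Hr : - (2 - a) / 6 < Re w) by (apply Rnot_le_lt; intros Hle; apply N; auto).
      destruct (cubic_positive_root ((1 + a) / 12) ((1 - a) / 4)
        (Re w + (2 - a) / 6)) as (p & Hp & Ep); try lra.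
      exists p, 0; repeat split; trivial; [|rewrite E; lra]. simpl; simpl in Ep; lra.
    + set (t := Im w) in *.
      assert (Ht : 0 < t ^ 2) by nra.
      destruct (quartic_positive_root ((1 + a) / 12) ((1 - a) / 4)
        (Re w + (2 - a) / 6) ((1 + a) * t ^ 2)) as (p & Hp & Ep); try lra.
      { apply Rmult_lt_0_compat; lra. }
      exists p, (2 * t / p); repeat split; trivial; [|field; lra].
      apply Rmult_eq_reg_r with p; [|lra].
      replace (((1 + a) / 12 * (p ^ 3 - 3 * p * (2 * t / p) ^ 2 - 1) + (1 - a) / 4 * (p - 1)) * p)
        with ((1 + a) / 12 * p ^ 4 + (1 - a) / 4 * p ^ 2 - (2 - a) / 6 * p - (1 + a) * t ^ 2)
        by (field; lra).
      lra.
Qed.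

(** * Transfer to the image of the disk *)

Lemma connected_ext (A B : C -> Prop) : set_eq A B -> connected A -> connected B.
Proof.
  intros E HA U V HU HV HUV (z1 & B1 & U1) (z2 & B2 & V2).
  destruct (HA U V HU HV) as (z & Az & H).
  - intros z Az; now apply HUV, E.
  - exists z1; split; [now apply E|trivial].
  - exists z2; split; [now apply E|trivial].
  - exists z; split; [now apply E|trivial].
Qed.

Lemma convex_in_horizontal_direction_ext (A B : C -> Prop) :
  set_eq A B -> convex_in_horizontal_direction A -> convex_in_horizontal_direction B.
Proof.
  intros E [[[z Az] [HO HC]] HS]; split; [split; [|split]|].
  - exists z; now apply E.
  - now apply (open_ext A B).
  - now apply (connected_ext A B).
  - intros y; apply (connected_ext (fun w => A w /\ Im w = y)); trivial.
    intros w; rewrite (E w); tauto.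
Qed.

(** The exceptional values of [a] come from vanishing weights: at [a = 1] or [a = -1] one
    exponential is left, giving a half-strip for [c = 0], and a half-plane for [c = 2] and
    [a = -1]. *)
Theorem theorem2p4 :
  forall (c a : R) (H G : C -> C),
    0 <= c <= 2 -> -1 <= a <= 1 -> is_F c a H G ->
    convex_in_horizontal_direction (image (harmonic_map H G) unit_disk) /\
    (c = 0 ->
      (-1 < a < 1 ->
        set_eq (image (harmonic_map H G) unit_disk) horizontal_strip) /\
      (a = 1 ->
        set_eq (image (harmonic_map H G) unit_disk)
          (fun w => horizontal_strip w /\ - (1 / 2) < Re w)) /\
      (a = -1 ->
        set_eq (image (harmonic_map H G) unit_disk)
          (fun w => horizontal_strip w /\ Re w < 1 / 2))) /\
    (c = 2 ->
      (-1 < a ->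
        set_eq (image (harmonic_map H G) unit_disk) (slit_plane a)) /\
      (a = -1 ->
        set_eq (image (harmonic_map H G) unit_disk)
          (fun w => - (1 / 2) < Re w))).
Proof.
  intros c a H G Hc Ha HF.
  pose proof (image_is_F c a H G Ha HF) as E.
  assert (T : forall S, set_eq (shear_image c a) S ->
    set_eq (image (harmonic_map H G) unit_disk) S).
  { intros S ES w; rewrite (E w); apply ES. }
  split; [|split].
  - apply (convex_in_horizontal_direction_ext (shear_image c a)).
    + intros w; symmetry; apply E.
    + now apply shear_image_horizontally_convex.
  - intros ->; split; [|split]; intros Ha'; apply T.
    + now apply shear_image_strip_interior.
    + subst a; apply shear_image_strip_right.
    + subst a; apply shear_image_strip_left.
  - intros ->; split; intros Ha'; apply T.
    + apply shear_image_slit_plane; lra.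
    + subst a; apply shear_image_half_plane.
Qed.
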